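(* Let $X$ be a regular Hausdorff space with countable pseudocharacter (every point is a $G_\delta$-set). Then the following are equivalent: (1) $X$ is semi-metrizable; (2) $\mathcal{F}(X)$ is symmetrizable; (3) $\mathcal{F}(X)$ is semi-metrizable.
   Context: $\mathcal{F}(X)$ is the set of nonempty finite subsets of $X$ with the Vietoris topology (base: $\langle U_1,\dots,U_k\rangle=\{A: A\subset\bigcup_i U_i,\ A\cap U_j\neq\emptyset\ \forall j\}$, $U_i$ open in $X$). A symmetric on a set $Y$ is a function $d:Y\times Y\to[0,\infty)$ with $d(x,y)=0\iff x=y$ and $d(x,y)=d(y,x)$; put $B(x,\varepsilon)=\{y: d(x,y)<\varepsilon\}$. $Y$ is symmetrizable if there is a symmetric $d$ such that $U\subset Y$ is open iff for each $x\in U$ some $B(x,\varepsilon)\subset U$; $Y$ is semi-metrizable if there is a symmetric $d$ such that for every $x$, $\{B(x,\varepsilon):\varepsilon>0\}$ is a neighborhood base at $x$. *)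

(* Defs.v *)
From HB Require Import structures.
From mathcomp Require Import all_boot all_order.
From mathcomp Require Import boolp classical_sets cardinality topology.
From Stdlib Require Import Reals.

Set Implicit Arguments.
Unset Strict Implicit.
Unset Printing Implicit Defensive.

Local Open Scope classical_set_scope.

Definition is_symmetric (Y : Type) (d : Y -> Y -> R) : Prop :=
  (forall x y, Rle 0 (d x y)) /\
  (forall x y, d x y = 0%R <-> x = y) /\
  (forall x y, d x y = d y x).

Definition dball (Y : Type) (d : Y -> Y -> R) (x : Y) (eps : R) : set Y :=
  [set y | Rlt (d x y) eps].

Definition symmetrizable (Y : Type) (opn : set Y -> Prop) : Prop :=
  exists d : Y -> Y -> R, is_symmetric d /\
    forall U : set Y, opn U <->
      (forall x, U x -> exists eps : R, Rlt 0 eps /\ dball d x eps `<=` U).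

Definition is_nbhd (Y : Type) (opn : set Y -> Prop) (x : Y) (N : set Y) : Prop :=
  exists V : set Y, opn V /\ V x /\ V `<=` N.

Definition semi_metrizable (Y : Type) (opn : set Y -> Prop) : Prop :=
  exists d : Y -> Y -> R, is_symmetric d /\
    forall x : Y,
      (forall eps : R, Rlt 0 eps -> is_nbhd opn x (dball d x eps)) /\
      (forall N : set Y, is_nbhd opn x N ->
         exists eps : R, Rlt 0 eps /\ dball d x eps `<=` N).

Section Hyperspace.
Variable X : topologicalType.

Definition FX : Type := {A : set X | finite_set A /\ A !=set0}.

Definition vietoris_basic (Us : seq (set X)) : set FX :=
  [set A : FX | (forall x, proj1_sig A x -> exists2 U, U \in Us & U x) /\
                (forall U, U \in Us -> exists x, proj1_sig A x /\ U x)].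

Definition vietoris_open (W : set FX) : Prop :=
  forall A : FX, W A ->
    exists Us : seq (set X), (forall U, U \in Us -> open U) /\
      vietoris_basic Us A /\ vietoris_basic Us `<=` W.

End Hyperspace.

Definition countable_pseudocharacter (X : topologicalType) : Prop :=
  forall x : X, exists U : nat -> set X,
    (forall n, open (U n)) /\ \bigcap_n U n = [set x].

(* Main.v *)
(** If [d] semi-metrizes [X], the Hausdorff distance of [d] semi-metrizes the
    hyperspace. Conversely, a symmetric [D] of the hyperspace restricts on
    singletons to a symmetric [d] of [X], and [d] semi-metrizes [X] as soon as
    every [cl S = {x : every ball at x meets S}] is closed. Otherwise some [p]
    outside [cl S] is a limit of points [x_k] of [cl S], and each [x_k] is a limit
    of points [y_(k,j)] of [S], as in Arens' space; regularity and [{p}] being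
    a G_delta allow [x_k] and [y_(k,j)] to lie in open sets [G_k] shrinking to
    [p]. The finite sets [{y_(k,j), x_k, ..., x_(k+j)}] accumulate at [{p}].
    But by the [D]-ball criterion their family is closed: for fixed [k] they
    grow to an infinite set, so they accumulate nowhere, and for [k] tending to
    infinity they can only accumulate at [{p}], where small [D]-balls would
    produce a sequence of points of [S] converging to [p]. *)

From Stdlib Require Import Reals Lra.
Require Import Defs.
From mathcomp Require Import all_boot boolp classical_sets cardinality topology.

Set Implicit Arguments.
Unset Strict Implicit.
Unset Printing Implicit Defensive.

Local Open Scope classical_set_scope.
Local Open Scope R_scope.

(** * Radii and balls of a symmetric *)

Lemma inv_INR_gt0 n : 0 < / INR n.+1.
Proof. by apply: Rinv_0_lt_compat; apply: lt_0_INR; apply/ltP. Qed.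

Lemma inv_INR_le m n : (m <= n)%N -> / INR n.+1 <= / INR m.+1.
Proof.
move=> mn; apply: Rinv_le_contravar; first by apply: lt_0_INR; apply/ltP.
by apply: le_INR; apply/leP.
Qed.

Lemma inv_INR_eventually_lt e :
  0 < e -> exists n, forall m, (n <= m)%N -> / INR m.+1 < e.
Proof.
move=> /archimed_cor1[[|n] [ne n0]]; first by move/ltP: n0.
by exists n => m /inv_INR_le nm; lra.
Qed.

Lemma dball_sub (Y : Type) (d : Y -> Y -> R) (x : Y) e e' :
  e' <= e -> dball d x e' `<=` dball d x e.
Proof. by rewrite /dball => ee' y /=; lra. Qed.

Lemma dball_center (Y : Type) (d : Y -> Y -> R) (x : Y) e :
  is_symmetric d -> 0 < e -> dball d x e x.
Proof. by move=> [_ [d0 _]] e0; rewrite /dball /= (proj2 (d0 x x)). Qed.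

Lemma symmetric_gt0 (Y : Type) (d : Y -> Y -> R) (x y : Y) :
  is_symmetric d -> x <> y -> 0 < d x y.
Proof.
move=> [dge0 [d0 _]] xy; case: (Rle_lt_or_eq_dec _ _ (dge0 x y)) => // dxy.
by case: xy; apply/d0.
Qed.

Lemma common_radius (T : eqType) (s : seq T) (P : T -> R -> Prop) :
  (forall t e e', P t e -> e' <= e -> P t e') ->
  (forall t, t \in s -> exists e, 0 < e /\ P t e) ->
  exists e, 0 < e /\ forall t, t \in s -> P t e.
Proof.
move=> Pdown; elim: s => [|t s IHs] Ps; first by exists 1; split=> //; lra.
have [|e [e0 He]] := IHs; first by move=> u us; apply: Ps; rewrite inE us orbT.
have [|e' [e'0 He']] := Ps t; first by rewrite mem_head.
exists (Rmin e e'); split; first exact: Rmin_pos.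
move=> u; rewrite inE => /orP[/eqP->|us].
  exact: Pdown He' (Rmin_r _ _).
exact: Pdown (He _ us) (Rmin_l _ _).
Qed.

(** The least of finitely many positive distances serves as radius. This discards finitely many
    exceptional points when the ball criterion for openness is checked. *)
Lemma dball_avoid_seq (Y : Type) (T : eqType) (d : Y -> Y -> R) (x : Y)
    (s : seq T) (f : T -> Y) :
  is_symmetric d -> (forall t, t \in s -> x <> f t) ->
  exists e, 0 < e /\ forall t, t \in s -> ~ dball d x e (f t).
Proof.
move=> symd xf.
apply: (@common_radius _ s (fun t e => ~ dball d x e (f t))).
  by move=> t e e' nfe ee' fte; apply/nfe/(dball_sub ee').
move=> t /xf /(symmetric_gt0 symd) xt; exists (d x (f t)); split=> //.
by rewrite /dball /=; lra.
Qed.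

(** Since [opn] is an arbitrary predicate, the topological fact that a neighborhood of all its
    points is open enters as a hypothesis. *)
Lemma semi_metrizable_symmetrizable (Y : Type) (opn : set Y -> Prop) :
  (forall U, (forall x, U x -> is_nbhd opn x U) -> opn U) ->
  semi_metrizable opn -> symmetrizable opn.
Proof.
move=> opnP [d [symd dP]]; exists d; split=> // U; split=> [oU x Ux|UP].
  by apply: (proj2 (dP x)); exists U; do !split.
apply: opnP => x Ux; have [e [e0 eU]] := UP x Ux.
have [V [oV [Vx Ve]]] := proj1 (dP x) e e0.
by exists V; do !split=> //; apply: subset_trans eU.
Qed.

(* The distance of two points is [/ INR n.+1] for the least [n] such that
   [E n] separates them; it is passed through [Rmax] because a value obtained
   by choice need not be symmetric. *)
Lemma symmetric_of_relations (Y : Type) (E : nat -> Y -> Y -> Prop) :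
  (forall n x, E n x x) -> (forall n x y, E n x y -> E n y x) ->
  (forall m n x y, (m <= n)%N -> E n x y -> E m x y) ->
  (forall x y, (forall n, E n x y) -> x = y) ->
  exists d, is_symmetric d /\ forall n x y, d x y < / INR n.+1 <-> E n x y.
Proof.
move=> Erefl Esym Eanti Esep.
have val (z : Y * Y) :
    exists r, 0 <= r /\ forall n, r < / INR n.+1 <-> E n z.1 z.2.
  have [Ez|/existsNP Ez] := pselect (forall n, E n z.1 z.2).
    exists 0; split; first exact: Rle_refl.
    by move=> n; split=> // _; apply: inv_INR_gt0.
  have exN : exists n, `[< ~ E n z.1 z.2 >] by case: Ez => n /asboolP; exists n.
  have [n /asboolP nE nmin] := ex_minnP exN.
  exists (/ INR n.+1); split; first by have := inv_INR_gt0 n; lra.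
  move=> m; split=> [nm|Em].
    apply: contrapT => /asboolP /nmin /inv_INR_le; lra.
  apply: Rnot_le_lt => nm; case: nE; apply: Eanti Em.
  rewrite leqNgt; apply/negP => mn; move: nm; apply: Rlt_not_le.
  apply: Rinv_lt_contravar; last by apply: lt_INR; apply/ltP.
  by apply: Rmult_lt_0_compat; apply: lt_0_INR; apply/ltP.
have [f fP] := choice val.
have dP n x y : Rmax (f (x, y)) (f (y, x)) < / INR n.+1 <-> E n x y.
  have [_ /(_ n)[fE Ef]] := fP (x, y); have [_ /(_ n)[_ Ef']] := fP (y, x).
  split=> [fn|Exy]; first by apply: fE; move: fn; apply/Rle_lt_trans/Rmax_l.
  by apply: Rmax_lub_lt; [apply: Ef|apply: Ef'; apply: Esym].
have dge0 x y : 0 <= Rmax (f (x, y)) (f (y, x)).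
  by apply: Rle_trans (Rmax_l _ _); case: (fP (x, y)).
exists (fun x y => Rmax (f (x, y)) (f (y, x))); split; last exact: dP.
split; [exact: dge0|split=> x y; last exact: Rmax_comm]; split=> [d0|->].
  by apply: Esep => n; apply/dP; rewrite d0; apply: inv_INR_gt0.
apply: Rle_antisym => //; apply: Rnot_lt_le => /inv_INR_eventually_lt[n ny].
have := ny n (leqnn n); have /dP := Erefl n y; lra.
Qed.

(** * Neighborhoods shrinking to a point *)

Lemma is_nbhd_open (X : topologicalType) (U : set X) :
  (forall x, U x -> is_nbhd (@open X) x U) -> open U.
Proof.
move=> UP; rewrite openE => x /UP[V [oV [Vx VU]]].
by rewrite /interior nbhsE; exists V.
Qed.

(** By regularity [p] has neighborhoods [W n] with closure inside [U n]; [G k] intersects the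
    interiors of the first [k] of them. A point other than [p] misses some [U n], and the complement
    of [closure (W n)] then misses every [G k] with [k > n]. *)
Lemma regular_Gdelta_shrinking (X : topologicalType) (p : X) :
  @regular_space X -> countable_pseudocharacter X ->
  exists G : nat -> set X, (forall k, open (G k) /\ G k p) /\
    forall b, b <> p -> exists K V, [/\ open V, V b &
      forall k x, (K <= k)%N -> V x -> ~ G k x].
Proof.
move=> regX /(_ p)[U [oU Up]].
have exW n : exists W, nbhs p W /\ closure W `<=` U n.
  have [|W Wp WU] := regX p (U n); last by exists W.
  by apply: open_nbhs_nbhs; split=> //; have : [set p] p by []; rewrite -Up; apply.
have [W WP] := choice exW.
pose G := nat_rect (fun=> set X) setT (fun n S => S `&` (W n)°).
have GW n k x : (n < k)%N -> G k x -> W n x.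
  elim: k => // k IHk; rewrite ltnS leq_eqVlt => /orP[/eqP->|nk] [Gk Wk].
    exact: interior_subset Wk.
  exact: IHk.
exists G; split.
  elim=> [|k [oG Gp]]; first by split=> //; apply: openT.
  split; first by apply: openI => //; apply: open_interior.
  by split=> //; case: (WP k).
move=> b bp; have [n nU] : exists n, ~ U n b.
  apply/existsNP => Ub; apply: bp.
  by have : (\bigcap_n U n) b by []; rewrite Up.
exists n.+1, (~` closure (W n)); split.
- exact/closed_openC/closed_closure.
- by move=> /(proj2 (WP n)).
- by move=> k x nk ncl /(GW _ _ _ nk) /subset_closure.
Qed.

(** * Finite sets and the Vietoris topology *)

Section Hyperspace.
Variable X : topologicalType.
Implicit Types A B : FX X.

Lemma FX_eq A B : proj1_sig A `<=>` proj1_sig B -> A = B.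
Proof. by move: A B => [A pA] [B pB] /seteqP; apply: eq_exist. Qed.

Lemma FX_finite A : exists s : seq X, proj1_sig A = [set` s].
Proof. by case: A => A [finA ne]; apply/finite_seqP. Qed.

Lemma seq_FX_subproof (x : X) (s : seq X) :
  finite_set [set` x :: s] /\ [set` x :: s] !=set0.
Proof. by split; [apply: finite_seq|exists x; rewrite /= mem_head]. Qed.

(** The separate head makes the set nonempty by construction; [seq_FX x [::]] is a singleton. *)
Definition seq_FX (x : X) (s : seq X) : FX X :=
  exist _ [set` x :: s] (seq_FX_subproof x s).

Lemma seq_FXE (x : X) (s : seq X) (y : X) :
  proj1_sig (seq_FX x s) y = (y \in x :: s) :> Prop.
Proof. by []. Qed.

Lemma vietoris_open_sub (U : set X) :
  open U -> vietoris_open [set A : FX X | proj1_sig A `<=` U].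
Proof.
move=> oU A AU; exists [:: U]; split; first by move=> V; rewrite mem_seq1 => /eqP->.
split=> [|B [BU _] x /BU[V]]; last by rewrite mem_seq1 => /eqP->.
split=> [x /AU Ux|V]; first by exists U; rewrite ?mem_head.
have [_ [x Ax]] := proj2_sig A.
by rewrite mem_seq1 => /eqP->; exists x; split=> //; apply: AU.
Qed.

Lemma vietoris_open_meet (U : set X) :
  open U -> vietoris_open [set A : FX X | proj1_sig A `&` U !=set0].
Proof.
move=> oU A [x [Ax Ux]]; exists [:: U; setT]; split.
  by move=> V; rewrite in_cons mem_seq1 => /orP[] /eqP->; last exact: openT.
split=> [|B [_ meetB]]; last exact: (meetB U (mem_head _ _)).
split=> [y Ay|V]; first by exists setT; rewrite // in_cons mem_seq1 eqxx orbT.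
by rewrite in_cons mem_seq1 => /orP[] /eqP->; exists x.
Qed.

Lemma open_seqI (Us : seq (set X)) (p : X) :
  (forall U, U \in Us -> open U /\ U p) ->
  exists V, [/\ open V, V p & forall U, U \in Us -> V `<=` U].
Proof.
elim: Us => [|U Us IHUs] UsP; first by exists setT; split=> //; apply: openT.
have [V VUs|V [oV Vp VUs]] := IHUs.
  by apply: UsP; rewrite in_cons VUs orbT.
have [oU Up] := UsP U (mem_head _ _).
exists (U `&` V); split=> //; first exact: openI.
by move=> W; rewrite in_cons => /orP[/eqP->|/VUs VW] x [] // _ /VW.
Qed.

(** All members of a basic neighborhood of {p} contain [p], so their intersection serves as [V]. *)
Lemma vietoris_open_seq1 (W : set (FX X)) (p : X) :
  vietoris_open W -> W (seq_FX p [::]) ->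
  exists V, [/\ open V, V p & forall A, proj1_sig A `<=` V -> W A].
Proof.
move=> /[apply] -[Us [oUs [[sub meet] UsW]]].
have UsP U : U \in Us -> open U /\ U p.
  move=> UUs; split; first exact: oUs.
  by have [x [/=]] := meet U UUs; rewrite mem_seq1 => /eqP->.
have [V [oV Vp VUs]] := open_seqI UsP.
have [|U0 U0Us _] := sub p; first by rewrite /= mem_head.
exists V; split=> // A AV; apply: UsW; split=> [x Ax|U UUs].
  by exists U0 => //; apply/(VUs _ U0Us)/AV.
by have [_ [x Ax]] := proj2_sig A; exists x; split=> //; apply/(VUs _ UUs)/AV.
Qed.

Lemma vietoris_is_nbhd_open (W : set (FX X)) :
  (forall A, W A -> is_nbhd (@vietoris_open X) A W) -> vietoris_open W.
Proof.
move=> WP A /WP[V [oV [VA VW]]]; have [Us [oUs [UsA UsV]]] := oV A VA.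
by exists Us; do !split=> //; try exact: UsA.1; try exact: UsA.2;
  apply: subset_trans VW.
Qed.

(** * The Hausdorff distance on finite sets *)

Definition hausdorff_rel (d : X -> X -> R) (e : R) : FX X -> FX X -> Prop :=
  fun A B => (forall a, proj1_sig A a -> exists b, proj1_sig B b /\ d a b < e) /\
             (forall b, proj1_sig B b -> exists a, proj1_sig A a /\ d a b < e).

(** A point outside a finite set keeps a positive distance from all its members, so each set is
    contained in the other. *)
Lemma hausdorff_rel_eq (d : X -> X -> R) A B :
  is_symmetric d -> (forall e, 0 < e -> hausdorff_rel d e A B) -> A = B.
Proof.
move=> symd AB; have dC := symd.2.2.
have sub (C C' : FX X) :
    (forall e, 0 < e -> forall c, proj1_sig C c ->
       exists c', proj1_sig C' c' /\ d c c' < e) ->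
    proj1_sig C `<=` proj1_sig C'.
  move=> CC' c Cc; apply: contrapT => nC'c; have [s C'E] := FX_finite C'.
  have [|e [e0 se]] := @dball_avoid_seq _ _ d c s id symd.
    by move=> t ts ct; apply: nC'c; rewrite C'E ct.
  by have [c' []] := CC' e e0 c Cc; rewrite C'E => /se.
apply: FX_eq; split; apply: sub => e /AB[AB1 AB2] //.
by move=> b /AB2[a [Aa ab]]; exists a; rewrite dC.
Qed.

Lemma semi_metrizable_vietoris :
  semi_metrizable (@open X) -> semi_metrizable (@vietoris_open X).
Proof.
move=> [d [symd dP]]; have dC := symd.2.2.
have [|||A B AB|D [symD DP]] := @symmetric_of_relations (FX X)
    (fun n => hausdorff_rel d (/ INR n.+1)).
- move=> n A; split=> x Ax; exists x; split=> //;
    exact: (dball_center x symd (inv_INR_gt0 n)).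
- by move=> n A B [AB BA]; split=> [b /BA|a /AB] [c [Cc dc]];
    exists c; rewrite dC.
- by move=> m n A B /inv_INR_le mn [AB BA]; split=> [a /AB|b /BA] [c [Cc dc]];
    exists c; split=> //; lra.
- apply: (@hausdorff_rel_eq d) => // e /inv_INR_eventually_lt[n /(_ _ (leqnn n))].
  by have [AB1 AB2] := AB n => ne; split=> [a /AB1|b /AB2] [c [Cc dc]];
    exists c; split=> //; lra.
exists D; split=> // A; have [s AE] := FX_finite A; split=> [e|N [W [oW [WA WN]]]].
  move=> /inv_INR_eventually_lt[n /(_ _ (leqnn n)) ne].
  (* Balls of [d] need not be open; open sets inside them generate the basic neighborhood of [A]. *)
  have exV (a : X) : exists V, [/\ open V, V a & V `<=` dball d a (/ INR n.+1)].
    by have [V [oV [Va Vd]]] := proj1 (dP a) _ (inv_INR_gt0 n); exists V.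
  have [V VP] := choice exV.
  exists (vietoris_basic [seq V a | a <- s]); split; last split.
  + move=> B sB; exists [seq V a | a <- s]; split; last by split.
    by move=> _ /mapP[a _ ->]; case: (VP a).
  + split=> [x|_ /mapP[a sa ->]]; rewrite AE; first move=> sx.
      by exists (V x); [apply: map_f|case: (VP x)].
    by exists a; split=> //; case: (VP a).
  + move=> B [sub meet]; apply: Rlt_trans ne; apply/DP; split=> [a|b Bb].
      rewrite AE => sa; have [|b [Bb Vab]] := meet (V a); first exact: map_f.
      by exists b; split=> //; case: (VP a) => _ _; apply.
    have [_ /mapP[a sa ->] Vab] := sub b Bb.
    by exists a; rewrite AE; split=> //; case: (VP a) => _ _; apply.
have [Us [oUs [[sub meet] UsW]]] := oW A WA.
(* A double minimum, over the points of [A] and the members of [Us], gives one radius for all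
   incident pairs. *)
have [||e [e0 eP]] := @common_radius _ s
    (fun a e => forall U, U \in Us -> U a -> dball d a e `<=` U).
- by move=> a e e' eU e'e U UUs Ua; apply: subset_trans (eU U UUs Ua); exact: dball_sub.
- move=> a _; apply: (@common_radius _ Us (fun U e => U a -> dball d a e `<=` U)).
    by move=> U e e' eU e'e Ua; apply: subset_trans (eU Ua); exact: dball_sub.
  move=> U UUs; have [Ua|nUa] := pselect (U a); last by exists 1; split=> //; lra.
  have [|e [e0 eU]] := proj2 (dP a) U; last by exists e.
  by exists U; split; [apply: oUs|split].
have [n /(_ _ (leqnn n)) ne] := inv_INR_eventually_lt e0.
exists (/ INR n.+1); split=> [|B /DP[AB BA]]; first exact: inv_INR_gt0.
apply/WN/UsW; split=> [b /BA[a [Aa ab]]|U UUs].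
  have [U UUs Ua] := sub a Aa; exists U => //.
  by apply: (eP a _ U UUs Ua); [rewrite AE in Aa|rewrite /dball /=; lra].
have [a [Aa Ua]] := meet U UUs; have [b [Bb ab]] := AB a Aa.
exists b; split=> //.
by apply: (eP a _ U UUs Ua); [rewrite AE in Aa|rewrite /dball /=; lra].
Qed.
End Hyperspace.

(** * Closure under a symmetric *)

Definition symmetrizes (Y : Type) (opn : set Y -> Prop) (d : Y -> Y -> R) :=
  is_symmetric d /\ forall U : set Y, opn U <->
    forall x, U x -> exists eps : R, 0 < eps /\ dball d x eps `<=` U.

Definition dclosure (Y : Type) (d : Y -> Y -> R) (S : set Y) : set Y :=
  [set x | forall e, 0 < e -> dball d x e `&` S !=set0].

Lemma sub_dclosure (Y : Type) (d : Y -> Y -> R) (S : set Y) :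
  is_symmetric d -> S `<=` dclosure d S.
Proof. by move=> symd x Sx e e0; exists x; split=> //; apply: dball_center. Qed.

Lemma not_dclosure (Y : Type) (d : Y -> Y -> R) (S : set Y) (x : Y) :
  ~ dclosure d S x -> exists e, 0 < e /\ dball d x e `<=` ~` S.
Proof.
move=> /existsNP[e /not_implyP[e0 nS]]; exists e; split=> // y xy Sy.
by apply: nS; exists y.
Qed.

(** Removing from the space the [dclosure] of the complement of a ball leaves an open set that
    contains the center and lies in the ball. *)
Lemma dclosure_closed_semi_metrizable (Y : Type) (opn : set Y -> Prop)
    (d : Y -> Y -> R) :
  symmetrizes opn d -> (forall S, opn (~` dclosure d S)) -> semi_metrizable opn.
Proof.
move=> [symd dP] clS; exists d; split=> // x; split=> [e e0|N [V [oV [Vx VN]]]].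
  exists (~` dclosure d (~` dball d x e)); split=> //; split.
    by move=> /(_ e e0)[y []].
  move=> y nSy; apply: contrapT => nxy; apply: nSy.
  exact: sub_dclosure.
have [e [e0 eV]] := proj1 (dP V) oV x Vx.
by exists e; split=> //; apply: subset_trans VN.
Qed.

Lemma hausdorff_separate (X : topologicalType) (x y : X) :
  hausdorff_space X -> x <> y ->
  exists U V, [/\ open U, open V, U x, V y & forall z, U z -> ~ V z].
Proof.
rewrite open_hausdorff => hX /eqP /hX[[U V] /= [/set_mem Ux /set_mem Vy]].
move=> [oU oV /eqP UV0]; exists U, V; split=> // z Uz Vz.
by have : (U `&` V) z by []; rewrite UV0.
Qed.

(** Otherwise the complement of the range of [y] is an open neighborhood of [p]: some ball at [p]
    misses [S], and at any other point Hausdorff separation leaves finitely many terms to avoid. *)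
Lemma symmetrizes_cvg_dclosure (X : topologicalType) (d : X -> X -> R)
    (S : set X) (p : X) (y : nat -> X) :
  hausdorff_space X -> symmetrizes (@open X) d ->
  (forall i, S (y i)) ->
  (forall U, open U -> U p -> exists N, forall i, (N <= i)%N -> U (y i)) ->
  dclosure d S p.
Proof.
move=> hX [symd dP] Sy yp; apply: contrapT => nSp.
suff oy : open (~` range y).
  have [|N /(_ _ (leqnn N))] := yp _ oy; last by apply; exists N.
  by move=> [i _ yip]; apply: nSp; rewrite -yip; apply: sub_dclosure.
apply/dP => q nq; have [->|qp] := pselect (q = p).
  have [e [e0 eS]] := not_dclosure nSp.
  by exists e; split=> // z /eS nSz [i _ yz]; apply: nSz; rewrite -yz.
have [U [V [oU oV Uq Vp UV]]] := hausdorff_separate hX qp.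
have [e [e0 eU]] := proj1 (dP U) oU q Uq.
have [N yV] := yp V oV Vp.
have [|e' [e'0 e'y]] := @dball_avoid_seq _ _ d q (iota 0 N) y symd.
  by move=> i _ qy; apply: nq; exists i.
exists (Rmin e e'); split; first exact: Rmin_pos.
move=> z qz [i _ yz]; have [Ni|iN] := leqP N i.
  apply: (UV z); last by rewrite -yz; apply: yV.
  exact/eU/(dball_sub (Rmin_l e e')).
apply: (e'y i); first by rewrite mem_iota.
by rewrite yz; apply: dball_sub qz; apply: Rmin_r.
Qed.

(** * Restricting a symmetric of the hyperspace to singletons *)

Section Restriction.
Variables (X : topologicalType) (D : FX X -> FX X -> R).
Hypothesis hX : hausdorff_space X.
Hypothesis symD : symmetrizes (@vietoris_open X) D.

Definition singleton_dist (x y : X) := D (seq_FX x [::]) (seq_FX y [::]).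

Lemma seq_FX1_inj (x y : X) : seq_FX x [::] = seq_FX y [::] -> x = y.
Proof.
move=> /(f_equal (fun A => proj1_sig A x)) /= xy.
by apply/eqP; rewrite -mem_seq1 -xy mem_head.
Qed.

Lemma symmetrizes_singleton_dist : symmetrizes (@open X) singleton_dist.
Proof.
have [[Dge0 [D0 DC]] DP] := symD; rewrite /singleton_dist; split.
  split=> [x y|]; first exact: Dge0.
  split=> x y; last exact: DC.
  by split=> [/D0 /seq_FX1_inj|->] //; apply/D0.
move=> U; split=> [oU x Ux|UP].
  have [|e [e0 eU]] := proj1 (DP _) (vietoris_open_sub oU) (seq_FX x [::]).
    by move=> y /=; rewrite mem_seq1 => /eqP->.
  by exists e; split=> // y /eU; apply; rewrite /= mem_head.
(* [W] consists of the singletons of points of [U] and all non-singletons, so at singletons its ball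
   criterion is that of [U]. *)
pose W := [set A : FX X | forall x, A = seq_FX x [::] -> U x].
suff oW : vietoris_open W.
  apply: is_nbhd_open => x Ux; have [|V [oV Vx VW]] := vietoris_open_seq1 oW (p := x).
    by move=> y /seq_FX1_inj <-.
  exists V; split=> //; split=> // y Vy; apply: (VW (seq_FX y [::])) => // z /=.
  by rewrite mem_seq1 => /eqP->.
apply/DP => A WA; have [[x Ax]|nA] := pselect (exists x, A = seq_FX x [::]).
  have [e [e0 eU]] := UP x (WA x Ax).
  by exists e; split=> // B AB y By; apply: eU; rewrite /dball /= -Ax -By.
have [_ [a Aa]] := proj2_sig A.
have [b [Ab ab]] : exists b, proj1_sig A b /\ a <> b.
  apply: contrapT => /forallNP Aonly; apply: nA; exists a.
  apply: FX_eq; split=> b /=; rewrite mem_seq1; last by move/eqP->.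
  by move=> Ab; apply/eqP; apply: contrapT => ba; apply: (Aonly b); split=> // /esym.
(* Sets close to [A] meet both of two disjoint open sets, so they are not singletons. *)
have [V [V' [oV oV' Va V'b VV']]] := hausdorff_separate hX ab.
have [|e [e0 eV]] := proj1 (DP _) (vietoris_open_meet oV) A; first by exists a.
have [|e' [e'0 eV']] := proj1 (DP _) (vietoris_open_meet oV') A; first by exists b.
exists (Rmin e e'); split; first exact: Rmin_pos.
move=> B AB x Bx; exfalso.
have [y [By Vy]] := eV _ (dball_sub (Rmin_l e e') AB).
have [z [Bz Vz]] := eV' _ (dball_sub (Rmin_r e e') AB).
move: By Bz; rewrite Bx /= !mem_seq1 => /eqP yx /eqP zx.
by apply: (VV' x); rewrite -?yx // yx -zx.
Qed.

(** * Closedness of [dclosure] by an Arens-type construction *)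

Hypothesis regX : @regular_space X.
Hypothesis GdX : countable_pseudocharacter X.

Lemma dclosure_singleton_dist_closed (S : set X) :
  open (~` dclosure singleton_dist S).
Proof.
have symd := symmetrizes_singleton_dist; have [symD' DP] := symD.
move: symd; set d := singleton_dist => symd; have [symd' dP] := symd.
apply/dP => p nSp; apply: contrapT => /forallNP pfar.
have [G [GP Gsep]] := regular_Gdelta_shrinking p regX GdX.
(* By [pfar] every ball at [p] meets [dclosure d S]; the radius is cut down to stay in [G k]. *)
have exx k : exists x, [/\ d p x < / INR k.+1, dclosure d S x & G k x].
  have [oG Gp] := GP k; have [e [e0 eG]] := proj1 (dP _) oG p Gp.
  have em := Rmin_pos _ _ e0 (inv_INR_gt0 k).
  have /existsNP[x /not_implyP[px Sx]] :
      ~ (dball d p (Rmin e (/ INR k.+1)) `<=` ~` dclosure d S).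
    by move=> sub; apply: (pfar (Rmin e (/ INR k.+1))).
  exists x; split; last exact/eG/(dball_sub (Rmin_l e (/ INR k.+1))).
    exact: (dball_sub (Rmin_r e (/ INR k.+1)) px).
  exact: contrapT.
have [x xP] := choice exx.
have exy (z : nat * nat) :
    exists y, [/\ d (x z.1) y < / INR z.2.+1, S y & G z.1 y].
  have [_ Sx Gx] := xP z.1; have [oG _] := GP z.1.
  have [e [e0 eG]] := proj1 (dP _) oG _ Gx.
  have [y [xy Sy]] := Sx _ (Rmin_pos _ _ e0 (inv_INR_gt0 z.2)).
  exists y; split=> //; last exact/eG/(dball_sub (Rmin_l e (/ INR z.2.+1))).
  exact: (dball_sub (Rmin_r e (/ INR z.2.+1)) xy).
have [y yP] := choice exy.
(* For [z = (k, j)] this is {y_(k,j), x_k, ..., x_(k+j)}, with both end indices included. *)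
pose H z := seq_FX (y z) [seq x n | n <- iota z.1 z.2.+1].
have HG z b : proj1_sig (H z) b -> exists n, (z.1 <= n)%N /\ G n b.
  rewrite seq_FXE in_cons => /orP[/eqP->|/mapP[n]].
    by exists z.1; split=> //; case: (yP z).
  by rewrite mem_iota => /andP[zn _] ->; exists n; split=> //; case: (xP n).
have Hx z n : (z.1 <= n <= z.1 + z.2)%N -> proj1_sig (H z) (x n).
  move=> zn; rewrite seq_FXE in_cons; apply/orP; right; apply: map_f.
  by rewrite mem_iota addnS ltnS.
have xp n : x n <> p by move=> xnp; apply: nSp; rewrite -xnp; case: (xP n).
have xcvg e : 0 < e -> exists N, forall n, (N <= n)%N -> d p (x n) < e.
  move=> /inv_INR_eventually_lt[N Ne]; exists N => n /Ne.
  by apply: Rlt_trans; case: (xP n).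
have oH : vietoris_open (~` range H).
  apply/DP => B nHB; have [Bp|nBp] := pselect (B = seq_FX p [::]).
    (* If the sets [H (z i)] approach {p} in [D], their points [y (z i)] in [S] converge to [p]. *)
    apply: contrapT => /forallNP Bnear; apply: nSp.
    have exz i : exists z, D B (H z) < / INR i.+1.
      have := Bnear (/ INR i.+1); apply: contra_notP => /forallNP Bz.
      by split=> [|_ /[swap] -[z _ <-] /Bz //]; apply: inv_INR_gt0.
    have [z zP] := choice exz.
    apply: (symmetrizes_cvg_dclosure (y := y \o z) hX symd) => [i|U oU Up].
      by case: (yP (z i)).
    have [|e [e0 eU]] := proj1 (DP _) (vietoris_open_sub oU) B.
      by rewrite Bp => b /=; rewrite mem_seq1 => /eqP->.
    have [N Ne] := inv_INR_eventually_lt e0.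
    exists N => i Ni; apply: (eU (H (z i))); last by rewrite /= mem_head.
    exact: Rlt_trans (zP i) (Ne i Ni).
  have [b [Bb bp]] : exists b, proj1_sig B b /\ b <> p.
    apply: contrapT => /forallNP Bonly; apply: nBp.
    have {}Bonly b : proj1_sig B b -> b = p.
      by move=> Bb; apply: contrapT => bp; apply: (Bonly b).
    have [_ [b Bb]] := proj2_sig B.
    apply: FX_eq; split=> c /=; rewrite mem_seq1; first by move/Bonly->.
    by move/eqP->; rewrite -(Bonly b Bb).
  (* Requiring a set to meet [V] excludes all [H (k, j)] with [k >= K], whose points lie in sets
     [G n] with [n >= K]. *)
  have [K [V [oV Vb VG]]] := Gsep b bp.
  (* The [x n] differ from [p] and get closer to [p] than the other points of the finite set [B].
     Avoiding this [x m] excludes [H (k, j)] with [k < K] and [j >= m], since then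
     [k <= m <= k + j]. *)
  have [m [Km nBx]] : exists m, (K <= m)%N /\ ~ proj1_sig B (x m).
    have [s Bs] := FX_finite B.
    have [|e [e0 es]] := @dball_avoid_seq _ _ d p [seq c <- s | c != p] id symd'.
      by move=> c; rewrite mem_filter => /andP[/eqP cp _] /esym.
    have [N Ne] := xcvg e e0; exists (maxn K N); split; first exact: leq_maxl.
    rewrite Bs => /= sx; apply: (es (x (maxn K N))); last first.
      exact/Ne/leq_maxr.
    by rewrite mem_filter sx andbT; apply/eqP.
  have [|e1 [e10 e1V]] := proj1 (DP _) (vietoris_open_meet oV) B; first by exists b.
  have oxm : open (~` [set x m]).
    exact/closed_openC/accessible_closed_set1/hausdorff_accessible.
  have [|e2 [e20 e2x]] := proj1 (DP _) (vietoris_open_sub oxm) B.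
    by move=> c Bc /= cx; apply: nBx; rewrite -cx.
  (* Only the finitely many pairs with [k < K] and [j < m] remain. *)
  have [|e3 [e30 e3H]] := @dball_avoid_seq _ _ D B
      [seq (k, j) | k <- iota 0 K, j <- iota 0 m] H symD'.
    by move=> z _ BH; apply: nHB; exists z.
  exists (Rmin (Rmin e1 e2) e3); split; first by do 2?apply: Rmin_pos.
  move=> _ /[swap] -[[k j] _ <-] BH.
  have BH12 := dball_sub (Rmin_l _ _) BH.
  have [Kk|kK] := leqP K k.
    have [c [/HG[n [kn Gc]] Vc]] := e1V _ (dball_sub (Rmin_l _ _) BH12).
    by apply: (VG n c) => //; apply: leq_trans kn.
  have [jm|mj] := ltnP j m.
    apply: (e3H (k, j)); last exact: (dball_sub (Rmin_r _ _) BH).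
    by apply: allpairs_f; rewrite mem_iota.
  apply: (e2x _ (dball_sub (Rmin_r _ _) BH12) (x m)) => //; apply: Hx => /=.
  rewrite (leq_trans (ltnW kK) Km); exact: leq_trans mj (leq_addl _ _).
(* The contradiction: {p} is outside the closed family, yet [V] contains every [x n] with [n >= N]
   and, for large [j], also [y (N, j)], hence all of [H (N, j)]. *)
have [|V [oV Vp VH]] := vietoris_open_seq1 oH (p := p).
  move=> [z _ Hp]; have := Hx z z.1; rewrite Hp leqnn leq_addr /= mem_seq1.
  by move=> /(_ isT) /eqP /xp.
have [e [e0 eV]] := proj1 (dP _) oV p Vp; have [N Ne] := xcvg e e0.
have [e' [e'0 e'V]] := proj1 (dP _) oV (x N) (eV _ (Ne _ (leqnn N))).
have [j /(_ _ (leqnn j)) je'] := inv_INR_eventually_lt e'0.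
apply: (VH (H (N, j))); last by exists (N, j).
move=> b; rewrite seq_FXE in_cons => /orP[/eqP->|/mapP[n]].
  by apply: e'V; apply: Rlt_trans je'; case: (yP (N, j)).
by rewrite mem_iota => /andP[Nn _] ->; apply/eV/Ne.
Qed.

End Restriction.

(** * Equivalence of the three properties *)

Theorem theorem4p11 (X : topologicalType) :
  hausdorff_space X -> @regular_space X -> countable_pseudocharacter X ->
  (semi_metrizable (@open X) <-> symmetrizable (@vietoris_open X)) /\
  (symmetrizable (@vietoris_open X) <-> semi_metrizable (@vietoris_open X)).
Proof.
move=> hX regX GdX.
have semi_sym := semi_metrizable_symmetrizable (@vietoris_is_nbhd_open X).
have sym_semi : symmetrizable (@vietoris_open X) -> semi_metrizable (@open X).
  move=> [D symD]; have symd := symmetrizes_singleton_dist hX symD.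
  apply: (dclosure_closed_semi_metrizable symd) => S.
  exact: dclosure_singleton_dist_closed.
have semi_FX := @semi_metrizable_vietoris X.
split; split.
- by move/semi_FX/semi_sym.
- exact: sym_semi.
- by move/sym_semi/semi_FX.
- exact: semi_sym.
Qed.
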